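(* Let $p,q,r\ge 1$ with $p+q+r=n$, and let $A\in M_p(\mathbb{C})$, $C\in M_q(\mathbb{C})$, $E\in M_r(\mathbb{C})$ be Hermitian, $B\in M_{p\times q}(\mathbb{C})$, $D\in M_{q\times r}(\mathbb{C})$. For $X\in M_{p\times r}(\mathbb{C})$ let $$H(X)=\begin{pmatrix} A & B & X\\ B^\star & C & D\\ X^\star & D^\star & E\end{pmatrix}\in M_n(\mathbb{C}).$$ Assume that the two matrices $$\begin{pmatrix} A & B\\ B^\star & C\end{pmatrix}\quad\text{and}\quad \begin{pmatrix} C & D\\ D^\star & E\end{pmatrix}$$ are positive semidefinite and of maximal rank (with respect to the displayed partitions). Let $\mathcal{S}$ be the set of all $X\in M_{p\times r}(\mathbb{C})$ such that $H(X)$ is positive semidefinite and of maximal rank (with respect to the displayed $3\times 3$ block partition). Then $X_0=BC^+D$ belongs to $\mathcal{S}$, and $X_0$ is the unique element of $\mathcal{S}$ at which the generalized determinant ${\det}_+ H(X)$ attains its maximum over $X\in\mathcal{S}$.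
   Context: $M^\star$ denotes the conjugate transpose, $M^+$ the Moore-Penrose inverse, $N(M)$ the nullspace and $R(M)$ the range of a matrix $M$. Maximal rank: a positive semidefinite Hermitian matrix $\begin{pmatrix} P & Q\\ Q^\star & S\end{pmatrix}$, with square diagonal blocks $P,S$, is said to be of maximal rank (with respect to this partition) if its nullspace equals $N(P)\oplus N(S)$; equivalently, its rank equals $\operatorname{rank}P+\operatorname{rank}S$. Likewise, the positive semidefinite $3\times 3$ block matrix $H(X)$ is of maximal rank if $N(H(X))=N(A)\oplus N(C)\oplus N(E)$; equivalently, $\operatorname{rank}H(X)=\operatorname{rank}A+\operatorname{rank}C+\operatorname{rank}E$. Generalized determinant: for a nonzero Hermitian matrix $M$, ${\det}_+ M$ is the determinant of the linear map $M|_{R(M)}:R(M)\to R(M)$; for $M=0$, ${\det}_+ M=1$. *)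

(* Defs.v *)
From mathcomp Require Import all_boot all_order all_algebra.
From mathcomp Require Import spectral.

Set Implicit Arguments.
Unset Strict Implicit.
Unset Printing Implicit Defensive.

Import Order.TTheory GRing.Theory Num.Theory Num.Def.
Local Open Scope ring_scope.
Local Open Scope sesquilinear_scope.

(* In the partial order of a numClosedFieldType (e.g. R[i]), x <= y entails   *)
(* that y - x is real; thus [0 <= z] reads "z is real and nonnegative".       *)
Definition psdmx (C : numClosedFieldType) n (M : 'M[C]_n) : Prop :=
  M \is hermsymmx /\ forall x : 'cV[C]_n, 0 <= (x ^t* *m M *m x) 0 0.

Section Nullspaces.
Variable C : numClosedFieldType.

(* Matrices act on column vectors (mxalgebra's kermx is the row kernel). *)
Definition nullspace m n (M : 'M[C]_(m, n)) : {pred 'cV[C]_n} :=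
  [pred v | M *m v == 0].

Definition dirsum p q (U : {pred 'cV[C]_p}) (V : {pred 'cV[C]_q}) :
    {pred 'cV[C]_(p + q)} :=
  [pred v | (usubmx v \in U) && (dsubmx v \in V)].

Definition maximal_rank2 p q (M : 'M[C]_(p + q)) : Prop :=
  nullspace M =i dirsum (nullspace (ulsubmx M)) (nullspace (drsubmx M)).

Definition maximal_rank3 p q r (M : 'M[C]_(p + (q + r))) : Prop :=
  nullspace M =i
    dirsum (nullspace (ulsubmx M))
           (dirsum (nullspace (ulsubmx (drsubmx M)))
                   (nullspace (drsubmx (drsubmx M)))).

End Nullspaces.

Section GeneralizedDeterminant.
Variable F : fieldType.

(* The columns of [col_base M] are a basis of the range of M, and             *)
(* M = col_base M *m row_base M; so this is the matrix, in that basis, of the *)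
(* restriction of v |-> M *m v to the range of M (see [restr_rangeE]).        *)
Definition restr_range n (M : 'M[F]_n) : 'M[F]_(\rank M) :=
  row_base M *m col_base M.

Definition gdet n (M : 'M[F]_n) : F := \det (restr_range M).

Lemma restr_rangeE n (M : 'M[F]_n) :
  M *m col_base M = col_base M *m restr_range M.
Proof. by rewrite /restr_range mulmxA mulmx_base. Qed.

Lemma gdet_basis n k (M : 'M[F]_n) (B : 'M[F]_(n, k)) (T : 'M[F]_k) :
    row_free B^T -> (B^T :=: M^T)%MS -> M *m B = B *m T ->
  \det T = gdet M.
Proof.
move=> Bfree eqBM MB.
have ek : k = \rank M by move/eqP: Bfree; rewrite eqBM mxrank_tr.
subst k.
have cfree : row_free (col_base M)^T.
  by rewrite /row_free mxrank_tr; exact: col_base_full.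
have : (B^T <= (col_base M)^T)%MS.
  rewrite eqBM; apply/submxP; exists (row_base M)^T.
  by rewrite -trmx_mul mulmx_base.
case/submxP=> P /(congr1 trmx); rewrite trmxK trmx_mul trmxK => BE.
have Pu : P^T \in unitmx.
  rewrite unitmx_tr -row_free_unit /row_free eqn_leq rank_leq_row /=.
  have /eqP Pr : row_free (P *m (col_base M)^T).
    by rewrite -[P *m _]trmxK trmx_mul trmxK -BE.
  by apply: leq_trans (mxrankM_maxl P (col_base M)^T); rewrite Pr.
have full : row_full (col_base M) by exact: col_base_full.
have PT : P^T *m T = restr_range M *m P^T.
  apply: (row_full_inj full).
  rewrite mulmxA -BE -MB [in LHS]BE.
  by rewrite [LHS]mulmxA [RHS]mulmxA restr_rangeE.
have : \det P^T * \det T = \det P^T * gdet M.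
  by rewrite -det_mulmx PT det_mulmx mulrC.
by apply: mulrI; rewrite -unitmxE.
Qed.

Lemma gdet0 n : gdet (0 : 'M[F]_n) = 1.
Proof.
rewrite /gdet; move: (restr_range _); rewrite mxrank0 => T.
exact: det_mx00.
Qed.

Lemma gdet_unit n (M : 'M[F]_n) : M \in unitmx -> gdet M = \det M.
Proof.
move=> Mu; apply/esym/(@gdet_basis n n M 1%:M).
- by rewrite trmx1 row_free_unit unitmx1.
- by rewrite trmx1; apply/eqmxP; rewrite submx1 sub1mx row_full_unit unitmx_tr Mu.
- by rewrite mulmx1 mul1mx.
Qed.

End GeneralizedDeterminant.

Section MoorePenrose.
Variable C : numClosedFieldType.

Definition is_mpinv m n (A : 'M[C]_(m, n)) (G : 'M[C]_(n, m)) : Prop :=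
  [/\ A *m G *m A = A, G *m A *m G = G,
      (A *m G) ^t* = A *m G & (G *m A) ^t* = G *m A].

(* The formula for a full-rank factorization A = F *m K; see [mpinvP] and     *)
(* [is_mpinv_uniq].                                                           *)
Definition mpinv m n (A : 'M[C]_(m, n)) : 'M[C]_(n, m) :=
  let F := col_base A in let K := row_base A in
  K ^t* *m invmx (K *m K ^t*) *m (invmx (F ^t* *m F) *m F ^t*).

Lemma ctmx_mul m n p (A : 'M[C]_(m, n)) (B : 'M[C]_(n, p)) :
  (A *m B) ^t* = B ^t* *m A ^t*.
Proof. by rewrite trmx_mul map_mxM. Qed.

Lemma ctmxK m n (A : 'M[C]_(m, n)) : A ^t* ^t* = A.
Proof. by apply/matrixP=> i j; rewrite !mxE conjCK. Qed.

Lemma ctmx_inv n (A : 'M[C]_n) : (invmx A) ^t* = invmx (A ^t*).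
Proof. by rewrite trmx_inv map_invmx. Qed.

Lemma gram_unit k n (K : 'M[C]_(k, n)) :
  row_free K -> K *m K ^t* \in unitmx.
Proof.
move=> Kfree; rewrite -row_free_unit -kermx_eq0; apply/eqP/row_matrixP=> i.
rewrite row0; set u := row i _.
have uK : u *m (K *m K ^t*) = 0 by rewrite /u -row_mul mulmx_ker row0.
have : (u *m K) *m (u *m K) ^t* = 0 by rewrite ctmx_mul !mulmxA -(mulmxA u) uK mul0mx.
move/matrixP/(_ 0 0); rewrite !mxE => /eqP.
rewrite psumr_eq0 => [|j _]; last by rewrite !mxE mul_conjC_ge0.
move/allP=> z; apply: (row_free_inj Kfree); rewrite mul0mx.
apply/rowP=> j; rewrite [RHS]mxE.
have /implyP/(_ isT) := z j (mem_index_enum _).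
by rewrite !mxE mul_conjC_eq0 => /eqP.
Qed.

Lemma full_rank_mpinv m n k (F : 'M[C]_(m, k)) (K : 'M[C]_(k, n)) :
    row_free (F ^t*) -> row_free K ->
  is_mpinv (F *m K)
    (K ^t* *m invmx (K *m K ^t*) *m (invmx (F ^t* *m F) *m F ^t*)).
Proof.
move=> /gram_unit; rewrite ctmxK => Fu /gram_unit Ku; set G := _ *m (_ *m _).
have AG : F *m K *m G = F *m (invmx (F ^t* *m F) *m F ^t*).
  by rewrite /G !mulmxA -(mulmxA F K) mulmxK.
have GA : G *m (F *m K) = K ^t* *m invmx (K *m K ^t*) *m K.
  by rewrite /G -!mulmxA (mulmxA _ F K) mulKmx.
split.
- by rewrite AG -!mulmxA (mulmxA _ F K) mulKmx.
- by rewrite GA /G !mulmxA -(mulmxA _ K (K ^t*)) mulmxKV.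
- by rewrite AG !ctmx_mul ctmx_inv ctmx_mul !ctmxK mulmxA.
- by rewrite GA !ctmx_mul ctmx_inv ctmx_mul !ctmxK mulmxA.
Qed.

Lemma mpinvP m n (A : 'M[C]_(m, n)) : is_mpinv A (mpinv A).
Proof.
have Ffree : row_free ((col_base A) ^t*).
  by rewrite /row_free mxrank_map mxrank_tr; exact: col_base_full.
by have := full_rank_mpinv Ffree (row_base_free A); rewrite mulmx_base.
Qed.

Lemma is_mpinv_uniq m n (A : 'M[C]_(m, n)) G : is_mpinv A G -> G = mpinv A.
Proof.
move: (mpinvP A); set H := mpinv A => -[h1 h2 h3 h4] [g1 g2 g3 g4].
have AGH : A *m G = A *m H.
  have -> : A *m G = (A *m H) *m (A *m G) by rewrite mulmxA h1.
  by rewrite -[in LHS]h3 -[in LHS]g3 -ctmx_mul mulmxA g1 h3.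
have GHA : G *m A = H *m A.
  have -> : G *m A = (G *m A) *m (H *m A) by rewrite -mulmxA (mulmxA A) h1.
  by rewrite -[in LHS]h4 -[in LHS]g4 -ctmx_mul -mulmxA (mulmxA A) g1 h4.
by rewrite -g2 GHA -mulmxA AGH mulmxA.
Qed.

End MoorePenrose.

Section Completion.
Variables (C : numClosedFieldType) (p q r : nat).

Definition Hmx (A : 'M[C]_p) (B : 'M[C]_(p, q)) (Cm : 'M[C]_q)
    (D : 'M[C]_(q, r)) (E : 'M[C]_r) (X : 'M[C]_(p, r)) :
    'M[C]_(p + (q + r)) :=
  block_mx A                          (row_mx B X)
           (col_mx (B ^t*) (X ^t*))   (block_mx Cm D (D ^t*) E).

Definition max_rank_completion (A : 'M[C]_p) (B : 'M[C]_(p, q)) (Cm : 'M[C]_q)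
    (D : 'M[C]_(q, r)) (E : 'M[C]_r) (X : 'M[C]_(p, r)) : Prop :=
  psdmx (Hmx A B Cm D E X) /\ maximal_rank3 (Hmx A B Cm D E X).

End Completion.

(* Main.v *)
Require Import Defs.
From mathcomp Require Import all_boot all_order all_algebra.
From mathcomp Require Import spectral reals complex.

(** Everything is reduced to the positive definite case, where the statement is
Fischer's inequality with its equality case.

Reduction. Let KA, KC, KE be matrices with independent rows and the same
nullspaces as A, C, E, and K the block diagonal matrix that they form.
Maximality of the rank of the two given matrices forces B and D to vanish on
N(C) and N(E), and their adjoints on N(A) and N(C), so every given block is
the congruence by these matrices of a smaller block A', B', C', D', E', and
the two compressed matrices are positive definite ([psd_max2_pdmx]). In the
same way H(X) is psd of maximal rank exactly when X = KA^* X' KE and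
H(X) = K^* H'(X') K with H'(X') positive definite ([completion_coords],
[lift_completion]). Since the range of H(X) is then that of K^*, its
generalized determinant is det H'(X') times det K K^*, where the second factor
is positive and independent of X ([gdet_lift]). Under this correspondence
B C^+ D comes from B' C'^-1 D' ([mpinv_coords]).

Definite case. Eliminating the middle block by a unipotent congruence turns
H(X) into the matrix with diagonal blocks S1, C, S2, where S1 and S2 are Schur
complements of C, and a single pair of off-diagonal blocks Y and Y^*, where
Y = X - B C^-1 D ([Hmx_elim]). For Y = 0 this is block diagonal and positive
definite; by Fischer's inequality ([fischer]) any other Y for which it is
positive definite gives a strictly smaller determinant. Fischer's inequality is in turn the fact that adding a
psd matrix Q to a positive definite one increases the determinant, strictly
unless Q = 0 ([det_addmx_psd]), which after a congruence reads
det(1 + Q) = prod(1 + d_i) >= 1 for the eigenvalues d_i >= 0 of Q. *)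

Set Implicit Arguments.
Unset Strict Implicit.
Unset Printing Implicit Defensive.

Import Order.TTheory GRing.Theory Num.Theory.
Local Open Scope ring_scope.
Local Open Scope sesquilinear_scope.

(** * Conjugate transposes *)

Section Completion.
Variable F : numClosedFieldType.

Lemma ct_block m1 m2 n1 n2 (P : 'M[F]_(m1, n1)) (Q : 'M[F]_(m1, n2))
    (S : 'M[F]_(m2, n1)) (T : 'M[F]_(m2, n2)) :
  (block_mx P Q S T) ^t* = block_mx (P ^t*) (S ^t*) (Q ^t*) (T ^t*).
Proof. by rewrite tr_block_mx map_block_mx. Qed.

Lemma ct_row m n1 n2 (P : 'M[F]_(m, n1)) (Q : 'M[F]_(m, n2)) :
  (row_mx P Q) ^t* = col_mx (P ^t*) (Q ^t*).
Proof. by rewrite tr_row_mx map_col_mx. Qed.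

Lemma ct_col m1 m2 n (P : 'M[F]_(m1, n)) (Q : 'M[F]_(m2, n)) :
  (col_mx P Q) ^t* = row_mx (P ^t*) (Q ^t*).
Proof. by rewrite tr_col_mx map_row_mx. Qed.

Lemma ct0 m n : (0 : 'M[F]_(m, n)) ^t* = 0.
Proof. by rewrite trmx0 map_mx0. Qed.

Lemma ct1 n : (1%:M : 'M[F]_n) ^t* = 1%:M.
Proof. by rewrite trmx1 map_mx1. Qed.

Lemma ctD m n (M N : 'M[F]_(m, n)) : (M + N) ^t* = M ^t* + N ^t*.
Proof. by rewrite linearD /= map_mxD. Qed.

Lemma ctN m n (M : 'M[F]_(m, n)) : (- M) ^t* = - M ^t*.
Proof. by rewrite linearN /= map_mxN. Qed.

Lemma det_ct n (M : 'M[F]_n) : \det (M ^t*) = (\det M)^*.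
Proof. by rewrite det_map_mx det_tr. Qed.

Lemma ct_congr m n k l (K : 'M[F]_(k, m)) (V : 'M[F]_(k, l))
    (K' : 'M[F]_(l, n)) :
  K' ^t* *m V ^t* *m K = (K ^t* *m V *m K') ^t*.
Proof. by rewrite !ctmx_mul ctmxK !mulmxA. Qed.

Lemma hermsymmxP n (M : 'M[F]_n) : reflect (M ^t* = M) (M \is hermsymmx).
Proof.
rewrite is_hermitianmxE expr0 scale1r eq_sym; exact: eqP.
Qed.

(** * Positive semidefinite and positive definite matrices *)

(** For a psd matrix, invertibility amounts to definiteness, since x^* M x = 0
forces M x = 0; in this form definiteness can be read off nullspaces. *)
Definition pdmx n (M : 'M[F]_n) : Prop := psdmx M /\ M \in unitmx.

Lemma gram_psdmx m n (K : 'M[F]_(m, n)) : psdmx (K ^t* *m K).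
Proof.
split; first by apply/hermsymmxP; rewrite ctmx_mul ctmxK.
move=> x; rewrite mulmxA -ctmx_mul -mulmxA mxE sumr_ge0 // => i _.
by rewrite !mxE mulrC mul_conjC_ge0.
Qed.

Lemma psdmx_congr m n (L : 'M[F]_(m, n)) (M : 'M[F]_m) :
  psdmx M -> psdmx (L ^t* *m M *m L).
Proof.
case=> /hermsymmxP Mh Mge0; split=> [|x].
  by apply/hermsymmxP; rewrite !ctmx_mul ctmxK Mh mulmxA.
by have := Mge0 (L *m x); rewrite ctmx_mul !mulmxA.
Qed.

Lemma psdmx_spectral n (M : 'M[F]_n) : psdmx M ->
  exists2 P : 'M[F]_n, P \in unitmx &
  exists2 d : 'rV[F]_n, (forall i, 0 <= d 0 i) &
    invmx P = P ^t* /\ M = P ^t* *m diag_mx d *m P.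
Proof.
case=> Mh Mge0; have Mn := hermitian_normalmx Mh.
have Pu := spectral_unitarymx M; have Pi := invmx_unitary Pu.
have := orthomx_spectralP Mn; set d := spectral_diag M; rewrite Pi => MP.
have PMP : spectralmx M *m M *m (spectralmx M) ^t* = diag_mx d.
  by rewrite {2}MP !mulmxA (unitarymxP Pu) mul1mx mulmxtVK.
exists (spectralmx M); first exact: spectral_unit.
exists d => // i; have := Mge0 ((spectralmx M) ^t* *m delta_mx i 0).
rewrite ctmx_mul ctmxK !mulmxA -(mulmxA _ _ M) -(mulmxA _ _ ((_) ^t*)) PMP.
rewrite -mulmxA mul_diag_mx mxE (bigD1 i) //= big1 => [|j /negPf ji].
  by rewrite !mxE !eqxx conjC1 mul1r mulr1 addr0.
by rewrite !mxE ji !mulr0.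
Qed.

Lemma psdmx_gramP n (M : 'M[F]_n) : psdmx M ->
  exists N : 'M[F]_n, M = N ^t* *m N.
Proof.
case/psdmx_spectral=> P _ [d d_ge0 [_ ->]].
exists (diag_mx (map_mx sqrtC d) *m P).
rewrite ctmx_mul !mulmxA; congr (_ *m _).
rewrite -mulmxA; congr (_ *m _).
rewrite tr_diag_mx map_diag_mx mulmx_diag; congr diag_mx; apply/rowP=> i.
rewrite !mxE; have sd : 0 <= sqrtC (d 0 i) by rewrite sqrtC_ge0.
by move: (geC0_conj sd) => /= ->; rewrite -expr2 sqrtCK.
Qed.

Lemma pdmx_gramP n (M : 'M[F]_n) : pdmx M ->
  exists2 N : 'M[F]_n, N \in unitmx & M = N ^t* *m N.
Proof.
by case=> /psdmx_gramP[N ->]; rewrite unitmx_mul => /andP[_ Nu]; exists N.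
Qed.

Lemma row_free_ct m n (K : 'M[F]_(m, n)) : row_free (K ^t*) = row_full K.
Proof. by rewrite /row_free mxrank_map mxrank_tr. Qed.

Lemma pdmx_gram m n (K : 'M[F]_(m, n)) : row_full K -> pdmx (K ^t* *m K).
Proof.
rewrite -row_free_ct => /gram_unit; rewrite ctmxK => Ku.
by split=> //; apply: gram_psdmx.
Qed.

(** Writing [M] as a Gram matrix makes every congruence of it, principal
submatrices and Schur complements included, again a Gram matrix; this is why
the block lemmas below only have to exhibit [L]. *)
Lemma pdmx_congr m n (L : 'M[F]_(m, n)) (M : 'M[F]_m) :
  row_full L -> pdmx M -> pdmx (L ^t* *m M *m L).
Proof.
move=> Lfull /pdmx_gramP[N Nu ->].
rewrite !mulmxA -ctmx_mul -mulmxA; apply: pdmx_gram.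
by rewrite /row_full eqmxMfull // row_full_unit.
Qed.

Lemma pdmx_congrE n (L M : 'M[F]_n) : L \in unitmx ->
  pdmx (L *m M *m L ^t*) <-> pdmx M.
Proof.
move=> Lu; have Lct : L ^t* \in unitmx by rewrite map_unitmx unitmx_tr.
have full (K : 'M[F]_n) : K \in unitmx -> row_full K by rewrite row_full_unit.
split=> [|Mpd]; last by rewrite -{1}[L]ctmxK; apply: pdmx_congr; rewrite ?full.
move/(pdmx_congr (full (invmx (L ^t*)) _)); rewrite unitmx_inv => /(_ Lct).
by rewrite ctmx_inv ctmxK -mulmxA mulmxK // mulKmx.
Qed.

Lemma pdmx_det_gt0 n (M : 'M[F]_n) : pdmx M -> 0 < \det M.
Proof.
case/pdmx_gramP=> N; rewrite unitmxE unitfE => Nu ->.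
by rewrite det_mulmx det_ct mulrC mul_conjC_gt0.
Qed.

Lemma pdmx_herm n (M : 'M[F]_n) : pdmx M -> M ^t* = M.
Proof. by case=> -[/hermsymmxP]. Qed.

Lemma pdmx_inv n (M : 'M[F]_n) : pdmx M -> pdmx (invmx M).
Proof.
move=> /[dup] /pdmx_herm Mh /[dup] -[_ Mu] Mpd.
have := @pdmx_congr _ _ (invmx M) M; rewrite ctmx_inv Mh mulVmx // mul1mx.
by apply=> //; rewrite row_full_unit unitmx_inv.
Qed.

(** * Block matrices and Schur complements *)

(** The principal submatrices are the congruences by the two coordinate
inclusions. *)
Lemma pdmx_block m n (P : 'M[F]_m) (Z : 'M[F]_(m, n)) (W : 'M[F]_(n, m))
    (G : 'M[F]_n) :
  pdmx (block_mx P Z W G) -> pdmx P /\ pdmx G.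
Proof.
move=> pd; split.
- have := pdmx_congr _ pd; move/(_ _ (col_mx 1%:M 0)).
  rewrite ct_col ct1 ct0 mul_row_block mul_row_col !mul1mx !mul0mx !addr0.
  rewrite mulmx1 mulmx0 addr0; apply; apply/row_fullP.
  by exists (row_mx 1%:M 0); rewrite mul_row_col mul1mx mul0mx addr0.
- have := pdmx_congr _ pd; move/(_ _ (col_mx 0 1%:M)).
  rewrite ct_col ct1 ct0 mul_row_block mul_row_col !mul1mx !mul0mx !add0r.
  rewrite mulmx1 mulmx0 add0r; apply; apply/row_fullP.
  by exists (row_mx 0 1%:M); rewrite mul_row_col mul1mx mul0mx add0r.
Qed.

Lemma pdmx_diag m n (P : 'M[F]_m) (G : 'M[F]_n) :
  pdmx P -> pdmx G -> pdmx (block_mx P 0 0 G).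
Proof.
case/pdmx_gramP=> M Mu -> /pdmx_gramP[N Nu ->].
have -> : block_mx (M ^t* *m M) 0 0 (N ^t* *m N)
        = (block_mx M 0 0 N) ^t* *m block_mx M 0 0 N.
  by rewrite ct_block !ct0 mulmx_block !mulmx0 !mul0mx !addr0 !add0r.
apply: pdmx_gram; rewrite row_full_unit unitmxE det_ublock unitrM.
by rewrite -!unitmxE Mu.
Qed.

(** The Schur complement is the congruence by the inclusion of the first
coordinates into the graph { (x, - G^-1 Z^* x) }, on which the second block
row vanishes. *)
Lemma pdmx_schur_ul m n (P : 'M[F]_m) (Z : 'M[F]_(m, n)) (G : 'M[F]_n) :
  pdmx (block_mx P Z (Z ^t*) G) -> pdmx (P - Z *m invmx G *m Z ^t*).
Proof.
move=> /[dup] pd /pdmx_block[_ /[dup] /pdmx_herm Gh [_ Gu]].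
have := pdmx_congr _ pd; move/(_ _ (col_mx 1%:M (- invmx G *m Z ^t*))).
rewrite ct_col ct1 mul_row_block mul_row_col !mul1mx mulmx1.
rewrite ctmx_mul ctmxK ctN ctmx_inv Gh !mulmxN.
rewrite (mulNmx _ G) mulmxKV // addrN mul0mx addr0 !mulNmx; apply.
apply/row_fullP; exists (row_mx 1%:M 0).
by rewrite mul_row_col mul1mx mul0mx addr0.
Qed.

Lemma pdmx_schur_dr m n (P : 'M[F]_m) (Z : 'M[F]_(m, n)) (G : 'M[F]_n) :
  pdmx (block_mx P Z (Z ^t*) G) -> pdmx (G - Z ^t* *m invmx P *m Z).
Proof.
move=> /[dup] pd /pdmx_block[/[dup] /pdmx_herm Ph [_ Pu] _].
have := pdmx_congr _ pd; move/(_ _ (col_mx (- invmx P *m Z) 1%:M)).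
rewrite ct_col ct1 mul_row_block mul_row_col !mul1mx mulmx1.
rewrite ctmx_mul ctN ctmx_inv Ph !mulmxN.
rewrite (mulNmx _ P) mulmxKV // addNr mul0mx add0r !mulNmx addrC; apply.
apply/row_fullP; exists (row_mx 0 1%:M).
by rewrite mul_row_col mul1mx mul0mx add0r.
Qed.

(** * Determinant inequalities *)

Lemma prod_ge1_eq1 (I : finType) (f : I -> F) :
  (forall i, 1 <= f i) -> 1 <= \prod_i f i /\
  (\prod_i f i = 1 -> forall i, f i = 1).
Proof.
move=> f_ge1; split=> [|prod1 i].
  by elim/big_ind: _ => // x y; apply: mulr_ege1.
apply/eqP; rewrite eq_le f_ge1 andbT -prod1 (bigD1 i) //=.
rewrite ler_peMr ?(le_trans ler01) //.
by elim/big_ind: _ => // x y; apply: mulr_ege1.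
Qed.

(** In an orthonormal eigenbasis the determinant is the product of the 1 + d_i,
with d_i >= 0 the eigenvalues of [Q]. *)
Lemma det_1D_psdmx n (Q : 'M[F]_n) : psdmx Q ->
  1 <= \det (1%:M + Q) /\ (\det (1%:M + Q) = 1 -> Q = 0).
Proof.
case/psdmx_spectral=> P Pu [d d_ge0 [Pi ->]].
have -> : 1%:M + P ^t* *m diag_mx d *m P
        = invmx P *m diag_mx (const_mx 1 + d) *m P.
  by rewrite linearD /= diag_const_mx mulmxDr mulmxDl mulmx1 mulVmx // Pi.
rewrite !det_mulmx det_inv mulrAC mulVf ?mul1r;
  last by rewrite -unitfE -unitmxE.
rewrite det_diag; under eq_bigr do rewrite !mxE.
have [|ge1 eq1] := @prod_ge1_eq1 _ (fun i => 1 + d 0 i) _.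
  by move=> i; rewrite lerDl.
split=> // /eq1 d0; suff -> : d = 0.
  by rewrite (_ : diag_mx 0 = 0) ?mulmx0 ?mul0mx //; apply: raddf0.
by apply/rowP=> i; rewrite mxE; apply: (addrI 1); rewrite d0 addr0.
Qed.

(** The congruence that turns [T] into the identity multiplies both
determinants by the same positive number, so this is the case T = 1. *)
Lemma det_addmx_psd n (T Q : 'M[F]_n) : pdmx T -> psdmx Q ->
  \det T <= \det (T + Q) /\ (\det (T + Q) = \det T -> Q = 0).
Proof.
move=> Tpd Qpsd; have T_gt0 := pdmx_det_gt0 Tpd.
have [N Nu TE] := pdmx_gramP Tpd.
have Nct : N ^t* \in unitmx by rewrite map_unitmx unitmx_tr.
have [ge1 eq1] := det_1D_psdmx (psdmx_congr (invmx N) Qpsd).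
set Q' := _ *m _ *m _ in ge1 eq1.
have QE : Q = N ^t* *m Q' *m N.
  by rewrite /Q' ctmx_inv !mulmxA mulmxV // mul1mx mulmxKV.
have TQ : \det (T + Q) = \det T * \det (1%:M + Q').
  have -> : T + Q = N ^t* *m (1%:M + Q') *m N.
    by rewrite mulmxDr mulmx1 mulmxDl -QE -TE.
  by rewrite TE !det_mulmx mulrAC.
split; first by rewrite TQ ler_peMr // ltW.
rewrite TQ -[RHS]mulr1 => /(mulfI (lt0r_neq0 T_gt0)) /eq1 Q'0.
by rewrite QE Q'0 mulmx0 mul0mx.
Qed.

Lemma det_schur m n (P : 'M[F]_m) (Z : 'M[F]_(m, n)) (W : 'M[F]_(n, m))
    (G : 'M[F]_n) :
  G \in unitmx ->
  \det (block_mx P Z W G) = \det (P - Z *m invmx G *m W) * \det G.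
Proof.
move=> Gu; have -> : block_mx P Z W G = block_mx 1%:M (Z *m invmx G) 0 1%:M
    *m block_mx (P - Z *m invmx G *m W) 0 W G.
  by rewrite mulmx_block !mul1mx !mul0mx !add0r mulmxKV // subrK.
by rewrite det_mulmx det_ublock !det1 mul1r mul1r det_lblock.
Qed.

(** Fischer's inequality. Up to the factor det G, the left-hand side is the
determinant of the Schur complement P - Z G^-1 Z^*, from which [P] is obtained
by adding the psd matrix Z G^-1 Z^*; the latter vanishes only if [Z] does. *)
Lemma fischer m n (P : 'M[F]_m) (Z : 'M[F]_(m, n)) (G : 'M[F]_n) :
    pdmx (block_mx P Z (Z ^t*) G) ->
  \det (block_mx P Z (Z ^t*) G) <= \det (block_mx P 0 0 G)
  /\ (\det (block_mx P Z (Z ^t*) G) = \det (block_mx P 0 0 G) -> Z = 0).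
Proof.
move=> pd; have Tpd := pdmx_schur_ul pd; have [_ Gpd] := pdmx_block pd.
have /pdmx_gramP[N Nu GiE] := pdmx_inv Gpd.
have QE : Z *m invmx G *m Z ^t* = (N *m Z ^t*) ^t* *m (N *m Z ^t*).
  by rewrite GiE ctmx_mul ctmxK !mulmxA.
have Qpsd : psdmx (Z *m invmx G *m Z ^t*) by rewrite QE; apply: gram_psdmx.
have [le_det eq_det] := det_addmx_psd Tpd Qpsd.
rewrite subrK in le_det eq_det.
rewrite det_schur ?det_ublock; last by case: Gpd.
have G_gt0 := pdmx_det_gt0 Gpd; split; first by rewrite ler_pM2r.
move/(mulIf (lt0r_neq0 G_gt0))/esym/eq_det; rewrite QE => Q0.
(* The diagonal entries of the Gram matrix of N Z^* are the squared norms of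
   its columns. *)
suff NZ0 : N *m Z ^t* = 0.
  by rewrite -[Z]ctmxK -[Z ^t*](mulKmx Nu) NZ0 mulmx0 ct0.
apply/matrixP=> i j; move/matrixP/(_ j j): Q0; rewrite mxE [RHS]mxE => /eqP.
rewrite psumr_eq0 => [/allP/(_ i (mem_index_enum _))|k _].
  by rewrite !mxE mulrC mul_conjC_eq0 => /eqP.
by rewrite !mxE mulrC mul_conjC_ge0.
Qed.

(** * The positive definite completion problem *)

Section DefiniteCompletion.
Variables (p q r : nat) (A : 'M[F]_p) (C : 'M[F]_q) (E : 'M[F]_r).
Variables (B : 'M[F]_(p, q)) (D : 'M[F]_(q, r)).
Hypothesis ABCpd : pdmx (block_mx A B (B ^t*) C).
Hypothesis CDEpd : pdmx (block_mx C D (D ^t*) E).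

Let S1 := A - B *m invmx C *m B ^t*.
Let S2 := E - D ^t* *m invmx C *m D.
Let X0 := B *m invmx C *m D.
Let L : 'M[F]_(p + (q + r)) :=
  block_mx 1%:M (row_mx (B *m invmx C) 0)
    0 (block_mx 1%:M 0 (D ^t* *m invmx C) 1%:M).

Let Cpd : pdmx C. Proof. by have [] := pdmx_block ABCpd. Qed.

(** [L] is the block Gaussian elimination with pivot [C]. *)
Lemma det_elim : \det L = 1.
Proof. by rewrite det_ublock det_lblock !det1 !mulr1. Qed.

(** The pivot clears [B] and [D], replaces [A] and [E] by their Schur
complements, and translates the free corner by [X0]. *)
Lemma Hmx_elim X :
  Hmx A B C D E X = L *m Hmx S1 0 C 0 S2 (X - X0) *m L ^t*.
Proof.
have Ch := pdmx_herm Cpd; have [_ Cu] := Cpd.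
rewrite /Hmx /L !ct_block ct_row !ct0 !ct1.
rewrite !ctmx_mul ctmx_inv ctmxK Ch.
rewrite !(mulmx_block, mul_row_col, mul_mx_row, mul_col_mx, mul_block_col,
  mul_row_block, mulmx1, mul1mx, mulmx0, mul0mx, addr0, add0r, row_mx0, col_mx0,
  add_row_mx, add_col_mx, block_mx0).
rewrite ctD ctN /X0 !ctmx_mul ctmx_inv Ch !mulKVmx // !mulmxKV // !mulmxA.
rewrite subrK [B *m _ *m D + _]addrC subrK subrK.
by rewrite /S2 [D ^t* *m _ *m _ + _]addrC subrK.
Qed.

Lemma pdmx_Hmx_elim X :
  pdmx (Hmx A B C D E X) <-> pdmx (Hmx S1 0 C 0 S2 (X - X0)).
Proof.
by rewrite Hmx_elim; apply: pdmx_congrE; rewrite unitmxE det_elim unitr1.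
Qed.

Lemma det_Hmx_elim X : \det (Hmx A B C D E X) = \det (Hmx S1 0 C 0 S2 (X - X0)).
Proof. by rewrite Hmx_elim !det_mulmx det_ct det_elim conjC1 mul1r mulr1. Qed.

Lemma pdmx_completion : pdmx (Hmx A B C D E X0).
Proof.
apply/pdmx_Hmx_elim; rewrite subrr /Hmx !ct0 row_mx0 col_mx0.
apply: pdmx_diag; first exact: pdmx_schur_ul.
by apply: pdmx_diag => //; apply: pdmx_schur_dr.
Qed.

(** After elimination the off-diagonal part is the row (0, X - X0), which
Fischer's inequality compares with 0. *)
Lemma det_completion X : pdmx (Hmx A B C D E X) ->
  \det (Hmx A B C D E X) <= \det (Hmx A B C D E X0)
  /\ (\det (Hmx A B C D E X) = \det (Hmx A B C D E X0) -> X = X0).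
Proof.
move/pdmx_Hmx_elim; rewrite !det_Hmx_elim subrr /Hmx !ct0 row_mx0 col_mx0.
rewrite (_ : col_mx 0 _ = (row_mx 0 (X - X0)) ^t*); last by rewrite ct_row ct0.
case/fischer=> le_det eq_det; split=> // /eq_det.
by rewrite -row_mx0 => /eq_row_mx[_ /eqP]; rewrite subr_eq0 => /eqP.
Qed.

End DefiniteCompletion.

(** * Congruence by a matrix with independent rows *)

Section FullRankCongruence.
Variables (k n : nat) (K : 'M[F]_(k, n)) (G : 'M[F]_(n, k)) (T : 'M[F]_k).
Hypothesis KG : K *m G = 1%:M.

Let GK : G ^t* *m K ^t* = 1%:M. Proof. by rewrite -ctmx_mul KG ct1. Qed.

Lemma row_free_congrK : G ^t* *m (K ^t* *m T *m K) *m G = T.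
Proof. by rewrite !mulmxA GK mul1mx -mulmxA KG mulmx1. Qed.

(** [K] being onto, a null vector [u] of [T] lifts to the null vector G u of the
congruence, and the hypothesis says that K (G u) = u is then 0. *)
Lemma pdmx_of_congr :
    psdmx (K ^t* *m T *m K) ->
    (forall x : 'cV_n, K ^t* *m T *m K *m x = 0 -> K *m x = 0) -> pdmx T.
Proof.
move=> /(psdmx_congr G); rewrite row_free_congrK => Tpsd nullK.
split=> //; rewrite -unitmx_tr -row_free_unit -kermx_eq0.
apply/eqP/row_matrixP=> i; rewrite row0; set u := row i _.
have uT : T *m u^T = 0.
  by apply: trmx_inj; rewrite trmx_mul trmxK trmx0 /u -row_mul mulmx_ker row0.
have := nullK (G *m u^T); rewrite mulmxA -!mulmxA (mulmxA K) KG mul1mx uT.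
by rewrite mulmx0 => /(_ erefl) uT0; rewrite -[u]trmxK uT0 trmx0.
Qed.

Lemma congr_null (x : 'cV_n) : T \in unitmx ->
  (K ^t* *m T *m K *m x == 0) = (K *m x == 0).
Proof.
move=> Tu; apply/eqP/eqP=> [|Kx0]; last by rewrite -mulmxA Kx0 mulmx0.
move/(congr1 (mulmx (G ^t*))); rewrite !mulmxA GK mul1mx mulmx0.
by rewrite -mulmxA => /(congr1 (mulmx (invmx T))); rewrite mulKmx // mulmx0.
Qed.

(** The columns of K^* form a basis of the range of K^* T K, and in this basis
the map is given by T K K^*, the Gram matrix accounting for non-orthonormal rows of [K]. *)
Lemma gdet_congr : T \in unitmx ->
  gdet (K ^t* *m T *m K) = \det T * \det (K *m K ^t*).
Proof.
move=> Tu; rewrite -det_mulmx; apply/esym/(@gdet_basis _ _ _ _ (K ^t*)).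
- rewrite /row_free mxrank_tr mxrank_map mxrank_tr -/(row_free K).
  by apply/row_freeP; exists G.
- apply/eqmxP/andP; split; apply/submxP.
    exists ((G *m invmx T)^T); rewrite -trmx_mul; congr trmx.
    by rewrite !mulmxA -(mulmxA _ K) KG mulmx1 mulmxK.
  by exists ((T *m K)^T); rewrite -trmx_mul mulmxA.
- by rewrite !mulmxA.
Qed.

End FullRankCongruence.

(** * Factoring blocks through the ranges of the diagonal blocks *)

Lemma null_row_base m n l (A : 'M[F]_(m, n)) (x : 'M[F]_(n, l)) :
  (row_base A *m x == 0) = (A *m x == 0).
Proof.
have -> : A *m x = col_base A *m (row_base A *m x) by rewrite mulmxA mulmx_base.
rewrite -[in RHS](mulmx0 _ (col_base A)).
by rewrite (inj_eq (row_full_inj (col_base_full A))).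
Qed.

(** The rows of [K] are a basis of the row space of [M], so that [K] maps a
vector to coordinates of its class modulo N(M); [G] lifts them back. *)
Definition range_coords n k (M : 'M[F]_n) (K : 'M[F]_(k, n)) (G : 'M[F]_(n, k))
    : Prop :=
  K *m G = 1%:M /\ forall x : 'cV_n, (K *m x == 0) = (M *m x == 0).

Lemma range_coords_row_base n (M : 'M[F]_n) :
  range_coords M (row_base M) (pinvmx (row_base M)).
Proof.
by split=> [|x]; [rewrite mulmxVp ?row_base_free | rewrite null_row_base].
Qed.

(** [1 - G *m K] maps into N(K) = N(M), where [V] vanishes. *)
Lemma null_factor n k l (M : 'M[F]_n) (K : 'M[F]_(k, n)) (G : 'M[F]_(n, k))
    (V : 'M[F]_(l, n)) :
    range_coords M K G -> (forall x : 'cV_n, M *m x = 0 -> V *m x = 0) ->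
  V *m G *m K = V.
Proof.
case=> KG nullK nullV; apply/eqP; rewrite eq_sym -subr_eq0.
apply/eqP/matrixP=> i j.
have Mx0 : M *m ((1%:M - G *m K) *m delta_mx j (0 : 'I_1)) = 0.
  apply/eqP; rewrite -nullK mulmxA mulmxBr mulmx1 mulmxA KG mul1mx subrr.
  by rewrite mul0mx.
have := nullV _ Mx0; rewrite mulmxA mulmxBr mulmx1 mulmxA -colE.
by move/matrixP/(_ i 0); rewrite !mxE.
Qed.

(** A block that vanishes on N(Q), with an adjoint that vanishes on N(P), is
determined by its compression to coordinates. *)
Lemma null_factor2 m n k l (P : 'M[F]_m) (Q : 'M[F]_n) (K : 'M[F]_(k, m))
    (G : 'M[F]_(m, k)) (K' : 'M[F]_(l, n)) (G' : 'M[F]_(n, l))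
    (V : 'M[F]_(m, n)) :
    range_coords P K G -> range_coords Q K' G' ->
    (forall x : 'cV_m, P *m x = 0 -> V ^t* *m x = 0) ->
    (forall x : 'cV_n, Q *m x = 0 -> V *m x = 0) ->
  K ^t* *m (G ^t* *m V *m G') *m K' = V.
Proof.
move=> cP cQ /(null_factor cP) VGK /(null_factor cQ) VGK'.
have GKV : (G *m K) ^t* *m V = V.
  by rewrite -[in LHS](ctmxK V) -ctmx_mul mulmxA VGK ctmxK.
by rewrite !mulmxA -ctmx_mul GKV.
Qed.

Lemma null_factor_herm n k (P : 'M[F]_n) (K : 'M[F]_(k, n)) (G : 'M[F]_(n, k)) :
  range_coords P K G -> P ^t* = P -> K ^t* *m (G ^t* *m P *m G) *m K = P.
Proof. by move=> cP Ph; apply: (null_factor2 cP cP); rewrite ?Ph. Qed.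

(** * Reduction to the definite problem *)

Lemma block_rinv m1 m2 k1 k2 (K : 'M[F]_(k1, m1)) (G : 'M[F]_(m1, k1))
    (K' : 'M[F]_(k2, m2)) (G' : 'M[F]_(m2, k2)) :
  K *m G = 1%:M -> K' *m G' = 1%:M ->
  block_mx K 0 0 K' *m block_mx G 0 0 G' = 1%:M.
Proof.
move=> KG KG'; rewrite mulmx_block KG KG' !mulmx0 !mul0mx !addr0 add0r.
by rewrite -scalar_mx_block.
Qed.

Lemma block_null m1 m2 k1 k2 (K : 'M[F]_(k1, m1)) (K' : 'M[F]_(k2, m2))
    (x : 'cV[F]_(m1 + m2)) :
  (block_mx K 0 0 K' *m x == 0) = (K *m usubmx x == 0) && (K' *m dsubmx x == 0).
Proof.
by rewrite -{1}[x]vsubmxK mul_block_col !mul0mx addr0 add0r col_mx_eq0.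
Qed.

Lemma block_congr m1 m2 k1 k2 (K : 'M[F]_(k1, m1)) (K' : 'M[F]_(k2, m2))
    P Q S T :
  (block_mx K 0 0 K') ^t* *m block_mx P Q S T *m block_mx K 0 0 K'
  = block_mx (K ^t* *m P *m K) (K ^t* *m Q *m K')
             (K' ^t* *m S *m K) (K' ^t* *m T *m K').
Proof.
by rewrite ct_block !ct0 !mulmx_block !(mulmx0, mul0mx, addr0, add0r).
Qed.

(** Testing maximality of the rank on vectors (0, x) and (x, 0) shows that [Q]
vanishes on N(S) and Q^* on N(P), so all blocks factor through coordinates.
The compressed matrix is then invertible because the nullspace of the original
one is exactly that of the coordinate map. *)
Lemma psd_max2_pdmx m1 m2 k1 k2 (K : 'M[F]_(k1, m1)) (G : 'M[F]_(m1, k1))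
    (K' : 'M[F]_(k2, m2)) (G' : 'M[F]_(m2, k2)) P Q S :
    range_coords P K G -> range_coords S K' G' ->
    psdmx (block_mx P Q (Q ^t*) S) -> maximal_rank2 (block_mx P Q (Q ^t*) S) ->
  [/\ K ^t* *m (G ^t* *m P *m G) *m K = P,
      K ^t* *m (G ^t* *m Q *m G') *m K' = Q,
      K' ^t* *m (G' ^t* *m S *m G') *m K' = S &
      pdmx (block_mx (G ^t* *m P *m G) (G ^t* *m Q *m G')
                    ((G ^t* *m Q *m G') ^t*) (G' ^t* *m S *m G'))].
Proof.
move=> cP cS psd maxr; have [KG nullP] := cP; have [KG' nullS] := cS.
have [Ph Sh] : P ^t* = P /\ S ^t* = S.
  by case: psd => /hermsymmxP + _; rewrite ct_block => /eq_block_mx[-> _ _ ->].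
have nullM (x : 'cV_(m1 + m2)) :
  (block_mx P Q (Q ^t*) S *m x == 0) = (block_mx K 0 0 K' *m x == 0).
  have := maxr x; rewrite block_null nullP nullS.
  by rewrite !inE block_mxKul block_mxKdr.
have nullQ (x : 'cV_m2) : S *m x = 0 -> Q *m x = 0.
  move=> Sx; have := nullM (col_mx 0 x); rewrite block_null col_mxKu col_mxKd.
  rewrite nullS Sx mulmx0 !eqxx mul_block_col !mulmx0 !add0r col_mx_eq0.
  by case/andP=> /eqP.
have nullQc (x : 'cV_m1) : P *m x = 0 -> Q ^t* *m x = 0.
  move=> Px; have := nullM (col_mx x 0); rewrite block_null col_mxKu col_mxKd.
  rewrite nullP Px mulmx0 !eqxx mul_block_col !mulmx0 !addr0 col_mx_eq0.
  by case/andP=> _ /eqP.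
have PE := null_factor_herm cP Ph.
have SE := null_factor_herm cS Sh.
have QE := null_factor2 cP cS nullQc nullQ.
split=> //.
have ME : (block_mx K 0 0 K') ^t*
    *m block_mx (G ^t* *m P *m G) (G ^t* *m Q *m G')
      ((G ^t* *m Q *m G') ^t*) (G' ^t* *m S *m G') *m block_mx K 0 0 K'
    = block_mx P Q (Q ^t*) S.
  by rewrite block_congr PE ct_congr QE SE.
apply: (pdmx_of_congr (block_rinv KG KG')); rewrite ME // => x /eqP.
by rewrite nullM => /eqP.
Qed.

Section BlockReduction.
Variables (p q r a c e : nat).
Variables (A : 'M[F]_p) (C : 'M[F]_q) (E : 'M[F]_r).
Variables (B : 'M[F]_(p, q)) (D : 'M[F]_(q, r)).
Variables (KA : 'M[F]_(a, p)) (GA : 'M[F]_(p, a)).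
Variables (KC : 'M[F]_(c, q)) (GC : 'M[F]_(q, c)).
Variables (KE : 'M[F]_(e, r)) (GE : 'M[F]_(r, e)).
Hypotheses (cA : range_coords A KA GA) (cC : range_coords C KC GC)
  (cE : range_coords E KE GE).
Hypotheses (psdABC : psdmx (block_mx A B (B ^t*) C))
    (maxABC : maximal_rank2 (block_mx A B (B ^t*) C))
    (psdCDE : psdmx (block_mx C D (D ^t*) E))
    (maxCDE : maximal_rank2 (block_mx C D (D ^t*) E)).

Let A' := GA ^t* *m A *m GA.
Let B' := GA ^t* *m B *m GC.
Let C' := GC ^t* *m C *m GC.
Let D' := GC ^t* *m D *m GE.
Let E' := GE ^t* *m E *m GE.

Let K : 'M_(a + (c + e), p + (q + r)) := block_mx KA 0 0 (block_mx KC 0 0 KE).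
Let G : 'M_(p + (q + r), a + (c + e)) := block_mx GA 0 0 (block_mx GC 0 0 GE).

Let H := Hmx A B C D E.
Let H' := Hmx A' B' C' D' E'.
Let S := max_rank_completion A B C D E.

Let KG : K *m G = 1%:M.
Proof. by rewrite !block_rinv ?(proj1 cA, proj1 cC, proj1 cE). Qed.

Let nullK (x : 'cV_(p + (q + r))) : (K *m x == 0) =
  [&& A *m usubmx x == 0, C *m usubmx (dsubmx x) == 0
    & E *m dsubmx (dsubmx x) == 0].
Proof. by rewrite !block_null (proj2 cA) (proj2 cC) (proj2 cE). Qed.

Lemma Hmx_congr X : K ^t* *m H' X *m K = H (KA ^t* *m X *m KE).
Proof.
have [AE BE CE _] := psd_max2_pdmx cA cC psdABC maxABC.
have [_ DE EE _] := psd_max2_pdmx cC cE psdCDE maxCDE.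
rewrite /H /H' /Hmx /K block_congr block_congr AE CE ct_congr DE EE.
congr block_mx.
- by rewrite mul_mx_row mul_row_block !mulmx0 addr0 add0r BE.
- rewrite ct_block !ct0 mul_block_col !mul0mx addr0 add0r mul_col_mx.
  by rewrite !ct_congr BE.
Qed.

(** As for [psd_max2_pdmx], test vectors (0, 0, z) and (x, 0, 0) show that [X]
factors through the coordinates of [A] and [E]. *)
Lemma completion_coords X : S X ->
  X = KA ^t* *m (GA ^t* *m X *m GE) *m KE /\ pdmx (H' (GA ^t* *m X *m GE)).
Proof.
case=> psdH maxH.
have nullH (x : 'cV_(p + (q + r))) : (H X *m x == 0) = (K *m x == 0).
  rewrite nullK; have := maxH x; rewrite !inE /Hmx.
  by rewrite block_mxKul block_mxKdr block_mxKul block_mxKdr.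
have nullX (z : 'cV_r) : E *m z = 0 -> X *m z = 0.
  move=> Ez; have := nullH (col_mx 0 (col_mx 0 z)).
  rewrite nullK !(col_mxKu, col_mxKd) Ez !mulmx0 !eqxx /H /Hmx.
  rewrite mul_block_col mul_row_col !mulmx0 !add0r col_mx_eq0.
  by case/andP=> /eqP.
have nullXc (x : 'cV_p) : A *m x = 0 -> X ^t* *m x = 0.
  move=> Ax; have := nullH (col_mx x 0).
  rewrite nullK !(col_mxKu, col_mxKd) !linear0 Ax !eqxx /H /Hmx.
  rewrite mul_block_col mul_col_mx !mulmx0 !addr0 !col_mx_eq0.
  by case/and3P=> _ _ /eqP.
have XE := null_factor2 cA cE nullXc nullX.
split=> //; apply: (pdmx_of_congr KG); rewrite Hmx_congr XE //.
by move=> x /eqP; rewrite nullH => /eqP.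
Qed.

Lemma lift_completion X : pdmx (H' X) -> S (KA ^t* *m X *m KE).
Proof.
move=> /[dup] -[psdX Xu] Xpd; split.
  by rewrite -/(H _) -Hmx_congr; apply: psdmx_congr.
move=> x; rewrite !inE block_mxKul block_mxKdr block_mxKul block_mxKdr.
by rewrite -/(H _) -Hmx_congr (congr_null KG) // nullK.
Qed.

(** The factor det K K^* is positive and does not depend on [X], so maximizing
the generalized determinant is maximizing the determinant of [H']. *)
Lemma gdet_lift X : pdmx (H' X) ->
  gdet (H (KA ^t* *m X *m KE)) = \det (H' X) * \det (K *m K ^t*).
Proof. by case=> _ Xu; rewrite -Hmx_congr (gdet_congr KG). Qed.

(** From C C^+ C = C, KC C^+ KC^* is the inverse of the compressed [C]:
cancel the outer factors KC^* and KC. *)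
Lemma mpinv_coords : B *m mpinv C *m D = KA ^t* *m (B' *m invmx C' *m D') *m KE.
Proof.
have [_ BE CE pd'] := psd_max2_pdmx cA cC psdABC maxABC.
have [_ DE _ _] := psd_max2_pdmx cC cE psdCDE maxCDE.
have [_ [_ Cu]] := pdmx_block pd'.
have [CmC _ _ _] := mpinvP C.
have CiE : KC *m mpinv C *m KC ^t* = invmx C'.
  have : C' *m (KC *m mpinv C *m KC ^t*) *m C' = C'.
    rewrite -[LHS](row_free_congrK _ (proj1 cC)).
    rewrite -[RHS](row_free_congrK _ (proj1 cC)); congr (_ *m _ *m _).
    rewrite CE -[RHS]CmC; move: (mpinv C) => P.
    by rewrite -[in RHS]CE !mulmxA.
  move/(congr1 (mulmx (invmx C'))); rewrite mulVmx // -mulmxA mulKmx //.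
  by move/(congr1 (mulmx^~ (invmx C'))); rewrite mulmxK // mul1mx.
by rewrite -CiE -[in LHS]BE -[in LHS]DE !mulmxA.
Qed.

Lemma max_rank_completion_gdet :
  let X0 := B *m mpinv C *m D in
  [/\ S X0, forall X, S X -> gdet (H X) <= gdet (H X0) &
      forall X1, S X1 -> (forall X, S X -> gdet (H X) <= gdet (H X1)) ->
        X1 = X0].
Proof.
move=> X0; have [_ _ _ ABCpd] := psd_max2_pdmx cA cC psdABC maxABC.
have [_ _ _ CDEpd] := psd_max2_pdmx cC cE psdCDE maxCDE.
have X0pd := pdmx_completion ABCpd CDEpd.
have K_gt0 : 0 < \det (K *m K ^t*).
  rewrite -[K in K *m _]ctmxK; apply/pdmx_det_gt0/pdmx_gram.
  by rewrite -row_free_ct ctmxK; apply/row_freeP; exists G.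
have SX0 : S X0 by rewrite /X0 mpinv_coords; apply: lift_completion.
split=> // [X SX|X1 SX1 maxX1].
  have [XE Xpd] := completion_coords SX.
  rewrite {1}XE /X0 mpinv_coords !gdet_lift // ler_pM2r //.
  by case: (det_completion ABCpd Xpd).
have [X1E X1pd] := completion_coords SX1.
have := maxX1 _ SX0.
rewrite {1}X1E /X0 mpinv_coords !gdet_lift // ler_pM2r // => ge_det.
have [le_det eq_det] := det_completion ABCpd X1pd.
by rewrite X1E eq_det //; apply/eqP; rewrite eq_le le_det.
Qed.

End BlockReduction.
End Completion.

Theorem theorem5p3 (R : realType) (p q r : nat)
    (hp : (1 <= p)%N) (hq : (1 <= q)%N) (hr : (1 <= r)%N)
    (A : 'M[R[i]]_p) (C : 'M[R[i]]_q) (E : 'M[R[i]]_r)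
    (B : 'M[R[i]]_(p, q)) (D : 'M[R[i]]_(q, r))
    (hA : A \is hermsymmx) (hC : C \is hermsymmx) (hE : E \is hermsymmx)
    (psdABC : psdmx (block_mx A B (B ^t*) C))
    (maxABC : maximal_rank2 (block_mx A B (B ^t*) C))
    (psdCDE : psdmx (block_mx C D (D ^t*) E))
    (maxCDE : maximal_rank2 (block_mx C D (D ^t*) E)) :
  let H := Hmx A B C D E in
  let S := max_rank_completion A B C D E in
  let X0 := B *m mpinv C *m D in
  [/\ S X0,
      (forall X, S X -> gdet (H X) <= gdet (H X0)) &
      (forall X1, S X1 -> (forall X, S X -> gdet (H X) <= gdet (H X1)) ->
         X1 = X0)].
Proof.
by apply: max_rank_completion_gdet psdABC maxABC psdCDE maxCDE;
  exact: range_coords_row_base.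
Qed.
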